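(* There exist a countable abelian group $G$ with $|\ker(D)|=\infty$ (where $D:G\to G$, $D(g)=2g$), a Følner sequence $\Phi$ in $G$ with $\alpha_\Phi=1$, and a set $A\subset G$ with $\overline{\mathrm{d}}_\Phi(A)=1$, such that for any infinite $B\subset G$ we have $B+B\not\subset A$.
   Context: For $g\in G$, $2g:=g+g$. For $C\subset G$, $C/2:=D^{-1}(C)=\{g\in G: 2g\in C\}$. A Følner sequence in $G$ is a sequence $\Phi=(\Phi_N)_{N\in\mathbb{N}}$ of (nonempty) finite subsets of $G$ with $\lim_{N\to\infty}\frac{|\Phi_N\cap(g+\Phi_N)|}{|\Phi_N|}=1$ for every $g\in G$. $\overline{\mathrm{d}}_\Phi(A)=\limsup_{N\to\infty}\frac{|A\cap\Phi_N|}{|\Phi_N|}$. The doubling ratio of $\Phi$ is $\alpha_\Phi=\liminf_{N\to\infty}\frac{|(\Phi_N/2)\cap\Phi_N|}{|\Phi_N|}$. $B+B=\{b_1+b_2: b_1,b_2\in B\}$ (with $b_1=b_2$ allowed). *)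

(* Defs.v *)
From HB Require Import structures.
From mathcomp Require Import all_boot all_order all_algebra.
From mathcomp Require Import finmap.
From mathcomp Require Import all_classical all_reals all_analysis.
Import Order.TTheory GRing.Theory Num.Theory.
Import numFieldNormedType.Exports.

Set Implicit Arguments.
Unset Strict Implicit.
Unset Printing Implicit Defensive.

Local Open Scope classical_set_scope.
Local Open Scope fset_scope.
Local Open Scope ring_scope.

Definition doubling (G : zmodType) (g : G) : G := g + g.

Definition half (G : zmodType) (C : set G) : set G := @doubling G @^-1` C.

Definition translate (G : zmodType) (g : G) (F : {fset G}) : {fset G} :=
  [fset (g + x : G) | x : G in F].

Definition sumset (G : zmodType) (B C : set G) : set G :=
  [set b + c | b in B & c in C].

(* |A `&` F| / |F|; A may be infinite, F is a finite set. *)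
Definition rel_density (R : realType) (G : zmodType) (A : set G)
    (F : {fset G}) : R :=
  #|` [fset x in F | x \in A]|%:R / #|` F|%:R.

Definition Folner (R : realType) (G : zmodType) (Phi : nat -> {fset G}) : Prop :=
  (forall N, Phi N != fset0) /\
  forall g : G,
    (fun N => rel_density R [set` translate g (Phi N)] (Phi N)) @ \oo
      --> (1 : R).

(* The limsup and liminf are taken in \bar R, where they always exist. *)
Definition upper_density (R : realType) (G : zmodType)
    (Phi : nat -> {fset G}) (A : set G) : \bar R :=
  limn_esup (fun N => (rel_density R A (Phi N))%:E).

Definition doubling_ratio (R : realType) (G : zmodType)
    (Phi : nat -> {fset G}) : \bar R :=
  limn_einf (fun N => (rel_density R (half [set` Phi N]) (Phi N))%:E).

(* Main.v *)
Require Import Defs.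
From HB Require Import structures.
From mathcomp Require Import all_boot all_order all_algebra.
From mathcomp Require Import finmap.
From mathcomp Require Import all_classical all_reals all_analysis.
Import Order.TTheory GRing.Theory Num.Theory.
Import numFieldNormedType.Exports.

Set Implicit Arguments.
Unset Strict Implicit.
Unset Printing Implicit Defensive.

Local Open Scope classical_set_scope.
Local Open Scope ring_scope.

(** In a group of exponent 2 every [b + b] is [0], so a set [B] with
    [B + B] inside [A] is empty as soon as [A] omits [0]; removing one point
    costs nothing in density along finite sets whose size tends to infinity.

    The group is the additive group of [{poly 'F_2}], a countable
    [F_2]-vector space of infinite dimension: doubling vanishes identically
    ([doubling_poly_F2]) and its kernel is the infinite group itself.  The
    sequence [polys_le 'F_2] is the exhaustion by the finite subgroups of
    polynomials of size at most [N].  Any [g] belongs to all of them from some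
    index on and then translates them to themselves, whence
    [polys_le_Folner].  Since [2g = 0] lies in each of them for every [g], the
    doubling ratio is the limit of a constant sequence equal to 1.  The set
    [A] of nonzero polynomials has relative density [1 - 2^-N] in the subgroup
    of index [N], whence [upper_density_polys_le_setC0]. *)

Lemma rel_density_full (R : realType) (G : zmodType) (A : set G)
    (F : {fset G}) :
  F != fset0 -> (forall x, x \in F -> A x) -> rel_density R A F = 1.
Proof.
move=> F0 FA; rewrite /rel_density.
have -> : [fset x in F | x \in A]%fset = F.
  apply/fsetP => x; rewrite !inE /=.
  by case: (boolP (x \in F)) => //= /FA; rewrite -in_setE => ->.
by rewrite divff // pnatr_eq0 cardfs_eq0.
Qed.

Lemma rel_density_setC1 (R : realType) (G : zmodType) (a : G) (F : {fset G}) :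
  a \in F -> rel_density R (~` [set a]) F = 1 - (#|` F|%:R)^-1.
Proof.
move=> aF; rewrite /rel_density.
have -> : [fset x in F | x \in ~` [set a]]%fset = (F `\ a)%fset.
  apply/fsetP => x; rewrite !inE /= andbC; congr andb.
  by apply/idP/idP; rewrite in_setE => /eqP.
have F0 : #|` F|%:R != 0 :> R.
  by rewrite pnatr_eq0 cardfs_eq0; apply/fset0Pn; exists a.
have -> : #|` (F `\ a)%fset|%:R = #|` F|%:R - 1 :> R.
  by rewrite (cardfsD1 a F) aF add1n -natr1 addrK.
by rewrite mulrBl divff // mul1r.
Qed.

(** Parametrizing by coefficient rows exhibits the set as finite and gives its
    cardinality through the injectivity of [rVpoly]. *)
Definition polys_le (F : finFieldType) (N : nat) : {fset {poly F}} :=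
  [fset rVpoly v | v in [set: 'rV[F]_N]%SET]%fset.

Lemma mem_polys_le (F : finFieldType) N (p : {poly F}) :
  (p \in polys_le F N) = (size p <= N)%N.
Proof.
apply/imfsetP/idP => [[v _ ->]|pN]; first exact: size_poly.
by exists (poly_rV p); rewrite ?inE // poly_rV_K.
Qed.

Lemma card_polys_le (F : finFieldType) N : #|` polys_le F N| = (#|F| ^ N)%N.
Proof.
rewrite card_imfset /=; last exact: can_inj rVpolyK.
by rewrite -cardE cardsT card_mx mul1n.
Qed.

Lemma zero_polys_le (F : finFieldType) N : 0 \in polys_le F N.
Proof. by rewrite mem_polys_le size_poly0. Qed.

Lemma polys_le_neq0 (F : finFieldType) N : polys_le F N != fset0.
Proof. by apply/fset0Pn; exists 0; exact: zero_polys_le. Qed.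

Lemma polys_le_Folner (R : realType) (F : finFieldType) :
  Folner R (polys_le F).
Proof.
split=> [N|g]; first exact: polys_le_neq0.
apply: cvg_near_cst; near=> N.
have gN : (size g <= N)%N by near: N; exact: nbhs_infty_ge.
apply: rel_density_full => [|x xN]; first exact: polys_le_neq0.
(* As [polys_le F N] is a subgroup containing [g], it also contains [x - g]. *)
apply/imfsetP; exists (x - g); last by rewrite addrC subrK.
move: xN; rewrite /= !mem_polys_le => xN.
by apply: leq_trans (size_polyD _ _) _; rewrite size_polyN geq_max xN.
Unshelve. all: by end_near. Qed.

Lemma upper_density_polys_le_setC0 (R : realType) (F : finFieldType) :
  upper_density R (polys_le F) (~` [set 0]) = 1%:E.
Proof.
apply: (cvg_limn_einf_sup _).2; apply: cvg_EFin; first exact: nearW.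
have F1 : (1 < #|F|)%N by exact: card_finNzRing_gt1.
have : (fun N => 1 - (#|F|%:R^-1 : R) ^+ N) @ \oo --> (1 - 0 : R).
  apply: cvgB; first exact: cvg_cst.
  apply: cvg_expr; rewrite ger0_norm ?invr_ge0 //.
  by rewrite invf_lt1 ?ltr0n ?ltr1n // ltnW.
rewrite subr0; apply: cvg_trans; apply: near_eq_cvg; apply: nearW => N /=.
by rewrite (rel_density_setC1 _ (zero_polys_le F N)) card_polys_le natrX exprVn.
Qed.

(** Degrees already take every natural number as a value. *)
Lemma infinite_poly (S : nzRingType) : infinite_set [set: {poly S}].
Proof.
move=> fin; apply: infinite_nat.
apply: sub_finite_set (finite_image (fun p : {poly S} => (size p).-1) fin).
by move=> n _; exists 'X^n => //; rewrite size_polyXn.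
Qed.

Lemma doubling_poly_F2 (p : {poly 'F_2}) : doubling p = 0.
Proof.
rewrite /doubling; apply/polyP => i.
by rewrite coefD coef0 -mulr2n -mulr_natr pchar_Fp_0 // mulr0.
Qed.

Theorem proposition5p1 (R : realType) :
  exists (G : zmodType) (Phi : nat -> {fset G}) (A : set G),
    [/\ countable [set: G],
        infinite_set [set g : G | doubling g = 0],
        Folner R Phi,
        doubling_ratio R Phi = 1%:E &
        upper_density R Phi A = 1%:E /\
        forall B : set G, infinite_set B -> ~ (sumset B B `<=` A)].
Proof.
exists {poly 'F_2}, (polys_le 'F_2), (~` [set 0]); split.
- exact: countableP.
- have -> : [set g : {poly 'F_2} | doubling g = 0] = setT.
    by apply/seteqP; split=> // p _; exact: doubling_poly_F2.
  exact: infinite_poly.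
- exact: polys_le_Folner.
- apply: (cvg_limn_einf_sup _).1; apply: cvg_near_cst; apply: nearW => N.
  congr EFin; apply: rel_density_full => [|x _]; first exact: polys_le_neq0.
  change (doubling x \in polys_le _ N).
  by rewrite doubling_poly_F2 zero_polys_le.
- split; first exact: upper_density_polys_le_setC0.
  move=> B Binf BA; apply: Binf.
  suff -> : B = set0 by exact: finite_set0.
  rewrite -subset0 => b Bb; apply: (BA 0) => //.
  by exists b => //; exists b => //; exact: doubling_poly_F2.
Qed.
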